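(* As a polynomial in $D$, \[ L(u)=\sum_{i=n+2}^{N}(-1)^iT^{(N-i)}_1\Bigl(u+\frac i2\Bigr)D^i-\sum_{i=0}^n(-1)^iT^{(i)}_1\Bigl(u+\frac i2\Bigr)D^i , \] where $T^{(0)}_1(u)=1$ (in particular the coefficient of $D^{n+1}$ is $0$). Equivalently, with the extension of $T^{(a)}_1$ to all $a\in\mathbb Z$ described below, $L(u)=-\sum_{i=0}^N(-1)^iT^{(i)}_1(u+\frac i2)D^i$.
   Context: Fix an integer $n\ge 2$ and put $N=2n+2$. Let $Q_a(u)$ ($1\le a\le n$, $u\in\mathbb C$) be algebraically independent commuting indeterminates, $\mathcal K$ the field of fractions of $\mathbb Z[Q_a(u)^{\pm1}]$. Put $d_a=1+\delta_{an}$, $Y_a(u)=Q_a(u-\frac{d_a}{2})/Q_a(u+\frac{d_a}{2})$ for $1\le a\le n$, $Y_0(u)=1$. Let $J=\{1\prec2\prec\cdots\prec n\prec\bar n\prec\cdots\prec\bar2\prec\bar1\}$. For $1\le a\le n$ set $z_a(u)=\frac{Y_a(u+\frac a2)}{Y_{a-1}(u+\frac{a+1}2)}$, $z_{\bar a}(u)=\frac{Y_{a-1}(u+\frac{2n-a+3}2)}{Y_a(u+\frac{2n-a+4}2)}$; set $x_a(u)=z_a(u)$, $x_{2n+3-a}(u)=z_{\bar a}(u)$ for $1\le a\le n$, and $x_{n+1}(u)=-x_{n+2}(u)=\frac{Q_n(u+\frac n2)Q_n(u+\frac{n+4}2)}{Q_n(u+\frac{n+2}2)^2}$. $D$ is the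 shift operator: difference operators $\sum_jc_j(u)D^j$ ($c_j(u)\in\mathcal K$) are multiplied using $D\,c(u)=c(u+1)D$. Define $L(u)=(x_1(u+n)-D)(x_2(u+n-1)-D)\cdots(x_N(u+n+1-N)-D)$ (factors in order $i=1,\dots,N$ from left to right, the $i$-th being $x_i(u+n+1-i)-D$). For $1\le a\le n$ define $T^{(a)}_1(u)$ by $T^{(a)}_1(u+\frac12)=\sum z_{i_1}(u+\frac{a-1}2)z_{i_2}(u+\frac{a-3}2)\cdots z_{i_a}(u-\frac{a-1}2)$, the sum over $(i_1,\dots,i_a)\in J^a$ with $i_1\prec\cdots\prec i_a$ such that whenever $i_k=c$, $i_l=\bar c$ for some $1\le c\le n$, one has $n+k-l\ge c$. Set $T^{(0)}_1(u)=1$, $T^{(a)}_1(u)=0$ for $a<0$, $T^{(n+1)}_1(u)=0$, and $T^{(a)}_1(u)=-T^{(N-a)}_1(u)$ for $a\ge n+2$ (so $T^{(N)}_1=-1$ and $T^{(a)}_1=0$ for $a>N$). *)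

(* Defs.v *)
From mathcomp Require Import all_boot all_algebra complex.
From mathcomp Require Import Rstruct.
Set Implicit Arguments. Unset Strict Implicit. Unset Printing Implicit Defensive.
Import GRing.Theory.
Local Open Scope ring_scope.

Definition CC : numClosedFieldType := (complex Rdefinitions.R).

Section Defs.
Variables (F : fieldType) (n : nat) (Q : nat -> CC -> F).

Definition hs (u : CC) (k : int) : CC := u + k%:~R / 2.

Definition dd (a : nat) : int := (1 + (a == n))%N.

Definition Y (a : nat) (u : CC) : F :=
  if a == 0%N then 1 else Q a (u - (dd a)%:~R / 2) / Q a (u + (dd a)%:~R / 2).

Definition z (a : nat) (u : CC) : F :=
  Y a (hs u a) / Y a.-1 (hs u (a + 1)%N).
Definition zbar (a : nat) (u : CC) : F :=
  Y a.-1 (hs u ((2 * n + 3)%N%:Z - a%:Z)) / Y a (hs u ((2 * n + 4)%N%:Z - a%:Z)).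

(* The alphabet J = {1 < ... < n < bar n < ... < bar 1} is encoded
   order-preservingly as {1, ..., 2n}: a |-> a and bar a |-> 2n+1-a. *)
Definition zJ (j : nat) (u : CC) : F :=
  if (j <= n)%N then z j u else zbar (2 * n + 1 - j) u.

Definition xX (u : CC) : F :=
  Q n (hs u n) * Q n (hs u (n + 4)%N) / (Q n (hs u (n + 2)%N)) ^+ 2.
Definition x (i : nat) (u : CC) : F :=
  if (i <= n)%N then z i u
  else if i == n.+1 then xX u
  else if i == n.+2 then - xX u
  else zbar (2 * n + 3 - i) u.

(* Admissible tuples: f : 'I_a -> 'I_(2n), the k-th letter (1-based k+1)
   being the element of J encoded by (f k) + 1. *)
Definition admissible (a : nat) (f : {ffun 'I_a -> 'I_(2 * n)}) : bool :=
  [forall k : 'I_a, forall l : 'I_a, (k < l)%N ==> (f k < f l)%N] &&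
  [forall k : 'I_a, forall l : 'I_a, forall c : 'I_n.+1,
     [&& (1 <= c)%N, (f k).+1 == c & (f l).+1 == (2 * n + 1 - c)%N]
       ==> (c + l <= n + k)%N].

(* T^{(a)}_1(u) for 0 <= a <= n, defined via T^{(a)}_1(u + 1/2) = sum ...,
   i.e. T^{(a)}_1(u) = sum prod_k z_{i_k}(u - 1/2 + (a+1-2k)/2)
                     = sum prod_k z_{i_k}(u + (a - 2k)/2)   (k = 1..a). *)
Definition T1 (a : nat) (u : CC) : F :=
  if a == 0%N then 1 else
  \sum_(f : {ffun 'I_a -> 'I_(2 * n)} | admissible f)
     \prod_(k < a) zJ (f k).+1 (hs u (a%:Z - (2 * k.+1)%N%:Z)).

(* Difference operators sum_j c_j(u) D^j as coefficient lists,
   multiplied with D c(u) = c(u+1) D. *)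
Definition dcoef (p : seq (CC -> F)) (j : nat) : CC -> F := nth (fun _ => 0) p j.

Definition dmul (p q : seq (CC -> F)) : seq (CC -> F) :=
  mkseq (fun k => fun u =>
           \sum_(j < k.+1) dcoef p j u * dcoef q (k - j) (u + j%:R))
        (size p + size q).-1.

Definition factor (i : nat) : seq (CC -> F) :=
  [:: (fun u => x i (u + (n.+1)%:R - i%:R)); (fun _ => -1)].

Definition Lop : seq (CC -> F) :=
  foldr (fun i acc => dmul (factor i) acc) [:: fun _ => 1] (iota 1 (2 * n + 2)).

End Defs.

(* Main.v *)
Require Import Defs.
From mathcomp Require Import all_boot all_order all_algebra complex.
From mathcomp Require Import Rstruct ring zify.
Set Implicit Arguments. Unset Strict Implicit. Unset Printing Implicit Defensive.
Import Order.TTheory GRing.Theory Num.Theory.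
Local Open Scope ring_scope.

(** Expanding the product, the coefficient of D^k in L(u) is (-1)^k E_(N-k)(u+n+1),
    where E_j(v) is the sum over increasing words i_1 < ... < i_j in all N letters
    of the products of the x_(i_k)(v-k).  Build E from the inside out: E^m uses
    the two middle letters and the m innermost pairs (b, bar b), n-m < b <= n, and
    T^m is the sum over the admissible words in those 2m letters (no middle ones).
    Both satisfy the same recursion when the pair (b, bar b) with b = n-m is
    added, except that T^(m+1)_j is cut off to 0 for j > m+1.  With
      w_m(u) = Y_b(u+b/2) / Y_b(u+b/2+1)
    one has z_b(u) bar z_b(u-m-1) = w_m(u) and z_b(u) bar z_b(u-m-2) = w_(m+1)(u),
    and by induction on m
      E^m_j = T^m_j for j <= m,
      E^m_(m+1+s)(v) = - w_m(v-1) ... w_m(v-s) T^m_(m+1-s)(v-s) for s >= 0,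
    the case m = 0 being x_(n+1)(u) x_(n+1)(u-1) = w_0(u).  Since w_n = 1, the case
    m = n is the theorem. *)

(** * Sums over increasing words *)

Section ElementarySums.
Variable F : fieldType.
Implicit Types (l : seq (CC -> F)) (x : CC -> F) (j : int) (v : CC).

(* [esum l j v] is the sum, over the subsequences [y_1 ... y_j] of [l], of the
   products of the [y_k (v - k)]; the integer index [j] may be negative. *)
Fixpoint esum l j v : F :=
  if l is x :: l' then esum l' j v + x (v - 1) * esum l' (j - 1) (v - 1)
  else (j == 0)%:R.

Lemma esum_lt0 l j v : j < 0 -> esum l j v = 0.
Proof.
elim: l j v => [|x l IH] j v jlt /=; first by case: eqP => // j0; exfalso; lia.
by rewrite !IH ?mulr0 ?addr0 //; lia.
Qed.

Lemma esum_gt_size l j v : (size l)%:Z < j -> esum l j v = 0.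
Proof.
elim: l j v => [|x l IH] j v /= jlt; first by case: eqP => // j0; exfalso; lia.
by move: (size l) jlt IH => s jlt IH; rewrite !IH ?mulr0 ?addr0 //; lia.
Qed.

(** The definition peels letters off the left; this peels one off the right. An appended letter is
    last in every word containing it, so in a word of length [j] it has position [j]. *)
Lemma esum_rcons l x j v :
  esum (rcons l x) j v = esum l j v + esum l (j - 1) v * x (v - j%:~R).
Proof.
elim: l j v => [|y l IH] j v /=.
  rewrite subr_eq0; have [->|_] := eqVneq j 1; first by rewrite mul1r mulr1.
  by rewrite mulr0 mul0r.
rewrite !IH mulrDr mulrDl !addrA; congr (_ + _); last first.
  by rewrite -mulrA; congr (_ * (_ * x _)); rewrite rmorphB /=; ring.
by rewrite -!addrA; congr (_ + _); rewrite addrC.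
Qed.

End ElementarySums.

Definition shiftprod (F : fieldType) (f : CC -> F) s v : F :=
  \prod_(i < s) f (v - i.+1%:R).

Lemma shiftprodSl (F : fieldType) (f : CC -> F) s v :
  shiftprod f s.+1 v = f (v - 1) * shiftprod f s (v - 1).
Proof.
rewrite /shiftprod big_ord_recl /=; congr (_ * _).
by apply: eq_bigr => i _; congr (f _); rewrite /bump /= add1n; ring.
Qed.

Lemma shiftprodSr (F : fieldType) (f : CC -> F) s v :
  shiftprod f s.+1 v = shiftprod f s v * f (v - s.+1%:R).
Proof. by rewrite /shiftprod big_ord_recr. Qed.

(** * The duality between short and long words *)

Section Duality.
Variables (F : fieldType) (n : nat) (z zb w : nat -> CC -> F).
Variables E T : nat -> int -> CC -> F.
Hypothesis wE : forall m u, (m < n)%N ->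
  z m u * zb m (u - m.+1%:R) = w m u.
Hypothesis wSE : forall m u, (m < n)%N ->
  z m u * zb m (u - m.+2%:R) = w m.+1 u.
Hypothesis E0 : forall j v, E 0 j v = (j == 0)%:R - (j == 2)%:R * w 0 (v - 1).
Hypothesis ES : forall m (j : int) v, (m < n)%N ->
  E m.+1 j v = E m j v + z m (v - 1) * E m (j - 1) (v - 1)
    + E m (j - 1) v * zb m (v - j%:~R)
    + z m (v - 1) * E m (j - 2) (v - 1) * zb m (v - j%:~R).
Hypothesis T0 : forall j v, T 0 j v = (j == 0)%:R.
Hypothesis T_gt : forall m (j : int) v, (m <= n)%N -> m%:Z < j -> T m j v = 0.
Hypothesis TS : forall m (j : int) v, (m < n)%N -> j <= m.+1%:Z ->
  T m.+1 j v = T m j v + z m (v - 1) * T m (j - 1) (v - 1)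
    + T m (j - 1) v * zb m (v - j%:~R)
    + z m (v - 1) * T m (j - 2) (v - 1) * zb m (v - j%:~R).

(** This and [wprodS_split] use the same [z] factors, while the [zb] factors differ by one step. So
    products of [w m] and of [w m.+1] differ only in boundary factors. *)
Lemma wprod_split m s v : (m < n)%N ->
  shiftprod (w m) s v = shiftprod (z m) s v * shiftprod (zb m) s (v - m.+1%:R).
Proof.
move=> mn; rewrite /shiftprod -big_split; apply: eq_bigr => i _ /=.
by rewrite -wE // addrAC.
Qed.

Lemma wprodS_split m s v : (m < n)%N ->
  shiftprod (w m.+1) s v = shiftprod (z m) s v * shiftprod (zb m) s (v - m.+2%:R).
Proof.
move=> mn; rewrite /shiftprod -big_split; apply: eq_bigr => i _ /=.
by rewrite -wSE // addrAC.
Qed.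

Lemma duality m : (m <= n)%N ->
  (forall (j : int) v, j <= m%:Z -> E m j v = T m j v) /\
  (forall s v, E m (m.+1 + s)%N%:Z v
     = - (shiftprod (w m) s v * T m (m.+1%:Z - s%:Z) (v - s%:R))).
Proof.
elim: m => [_|m IH mn].
  split=> [j v j0|s v].
    by rewrite E0 T0 (_ : (j == 2) = false) ?mul0r ?subr0 //; lia.
  rewrite E0 T0; case: s => [|[|s]].
  - by rewrite /= !mulr0n mulr0 mul0r oppr0 addr0.
  - by rewrite /shiftprod big_ord1 /= mul1r mulr1 sub0r.
  - by rewrite (_ : (_ == 2) = false) 1?(_ : (_ - _ == 0) = false) /=;
      [ring | lia | lia].
have [IH1 IH2] := IH (ltnW mn).
(* The low range extends to [j = m+1], where both sides vanish: the second half of the induction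
   hypothesis at [s = 0] has the factor [T m m.+1 = 0]. *)
have IH3 (j : int) v : j <= m.+1%:Z -> E m j v = T m j v.
  move=> jm; have [|jm'] := boolP (j <= m%:Z); first exact: IH1.
  have -> : j = (m.+1 + 0)%N%:Z by lia.
  rewrite IH2 !T_gt; [by rewrite mulr0 oppr0|lia|lia|lia|lia].
split=> [j v jm|]; first by rewrite ES // TS // !IH3 //; lia.
case=> [|s] v.
  (* For [s = 0] the index m+2 is beyond the range of [TS], and the claim is that [E] vanishes. The
     one-letter terms contain [T m m.+1 = 0]; the other two are opposite, since [z m] times the
     shifted [zb m] is [w m]. *)
  rewrite ES // subr0 (T_gt _ (m := m.+1)) //; last by lia.
  have -> : ((m.+2 + 0)%N%:Z = (m.+1 + 1)%N%:Z) by lia.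
  have -> : ((m.+1 + 1)%N%:Z - 1 = (m.+1 + 0)%N%:Z) by lia.
  have -> : ((m.+1 + 1)%N%:Z - 2 = m%:Z) by lia.
  rewrite !IH2 !(T_gt (m := m) (j := m.+1%:Z - 0%:Z)); try lia.
  have -> : m.+1%:Z - 1%:Z = m%:Z by lia.
  rewrite IH1 // /shiftprod big_ord1 -wE //.
  have -> : v - 1 - m.+1%:R = v - (m.+1 + 1)%N%:~R :> CC by rewrite -pmulrn natrD; ring.
  ring.
rewrite ES //.
have -> : (m.+2 + s.+1)%N%:Z = (m.+1 + s.+2)%N%:Z by lia.
have -> : (m.+1 + s.+2)%N%:Z - 1 = (m.+1 + s.+1)%N%:Z by lia.
have -> : (m.+1 + s.+2)%N%:Z - 2 = (m.+1 + s)%N%:Z by lia.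
rewrite !IH2 TS //; last by lia.
have -> : m.+2%:Z - s.+1%:Z - 1 = m.+1%:Z - s.+1%:Z by lia.
have -> : m.+2%:Z - s.+1%:Z - 2 = m.+1%:Z - s.+2%:Z by lia.
have -> : m.+2%:Z - s.+1%:Z = m.+1%:Z - s%:Z by lia.
have -> : v - 1 - s%:R = v - s.+1%:R :> CC by ring.
have -> : v - 1 - s.+1%:R = v - s.+2%:R :> CC by ring.
have -> : v - s.+1%:R - 1 = v - s.+2%:R :> CC by ring.
have -> : v - s.+1%:R - (m.+1%:Z - s%:Z)%:~R = v - m.+2%:R :> CC.
  by rewrite rmorphB /=; ring.
have -> : v - (m.+1 + s.+2)%N%:~R = v - s.+1%:R - m.+2%:R :> CC.
  by rewrite -pmulrn natrD; ring.
have v2 : v - m.+1%:R - 1 = v - m.+2%:R :> CC by ring.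
have v3 : v - 1 - m.+1%:R = v - m.+2%:R :> CC by ring.
have v4 : v - m.+1%:R - s.+2%:R = v - s.+1%:R - m.+2%:R :> CC by ring.
have v5 : v - m.+2%:R - s.+1%:R = v - s.+1%:R - m.+2%:R :> CC by ring.
(* Passing from length m+1+s to m+1-s reverses the recursion: the term of [ES] with neither new
   letter matches the term of [TS] with both ([wA]), and conversely ([wD]). The terms with only [z]
   or only [zb] match each other ([wB], [wC]). *)
have wA : shiftprod (w m.+1) s.+1 v * (z m (v - s.+2%:R) * zb m (v - m.+2%:R))
          = shiftprod (w m) s.+2 v.
  rewrite wprodS_split // wprod_split // (shiftprodSr (z m) s.+1).
  by rewrite (shiftprodSl (zb m) s.+1) v2; ring.
have wB : shiftprod (w m.+1) s.+1 v * z m (v - s.+2%:R)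
          = z m (v - 1) * shiftprod (w m) s.+1 (v - 1).
  rewrite wprodS_split // wprod_split // mulrAC -shiftprodSr shiftprodSl v3; ring.
have wC : shiftprod (w m.+1) s.+1 v * zb m (v - m.+2%:R)
          = shiftprod (w m) s.+1 v * zb m (v - s.+1%:R - m.+2%:R).
  rewrite wprodS_split // wprod_split // -!mulrA -v4 -shiftprodSr.
  by rewrite (shiftprodSl (zb m) s.+1) v2 [X in _ * X]mulrC.
have wD : shiftprod (w m.+1) s.+1 v
   = z m (v - 1) * zb m (v - s.+1%:R - m.+2%:R) * shiftprod (w m) s (v - 1).
  rewrite wprodS_split // wprod_split // shiftprodSl (shiftprodSr (zb m)) v3 v5.
  ring.
set t0 := T m _ _; set t1 := T m _ _; set t2 := T m _ _; set t3 := T m _ _.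
rewrite -[shiftprod (w m) s.+2 v]wA; transitivity (- (
    shiftprod (w m.+1) s.+1 v * (z m (v - s.+2%:R) * zb m (v - m.+2%:R)) * t0
    + (z m (v - 1) * shiftprod (w m) s.+1 (v - 1)) * t1
    + (shiftprod (w m) s.+1 v * zb m (v - s.+1%:R - m.+2%:R)) * t2
    + (z m (v - 1) * zb m (v - s.+1%:R - m.+2%:R)
       * shiftprod (w m) s (v - 1)) * t3)); first by ring.
rewrite -wB -wC -wD; ring.
Qed.

End Duality.

(** * The coefficients of L *)

Section LaxOperator.
Variables (F : fieldType) (n : nat) (Q : nat -> CC -> F).
Implicit Types (u v : CC).

Lemma dcoef_factor_mul i (p : seq (CC -> F)) k u :
  dcoef (dmul (factor n Q i) p) k u =
    x n Q i (u + n.+1%:R - i%:R) * dcoef p k u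
    - (if k is k'.+1 then dcoef p k' (u + 1) else 0).
Proof.
have p0 j w : (size p <= j)%N -> dcoef p j w = 0.
  by move=> h; rewrite /dcoef nth_default.
rewrite {1}/dcoef /dmul /=.
(* [dmul] truncates its list at length [(size p).+1]; from there on both terms on the right are
   default zeros. *)
have [kp|kp] := ltnP k (size p).+1; last first.
  rewrite nth_default ?size_mkseq // p0; last exact: ltnW.
  by case: k kp => [|k] //= kp; rewrite p0 // mulr0 subr0.
rewrite nth_mkseq //; case: k kp => [|k] kp.
  by rewrite big_ord1 /= addr0 subr0.
rewrite 2!big_ord_recl /= big1 ?addr0.
  by rewrite mulN1r /bump subn1.
by move=> j _; rewrite /dcoef /= nth_nil mul0r.
Qed.

(** Taking [-D] from [k] factors leaves a word in the other letters. Each [D] to the left of a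
    letter raises its argument by 1, which makes up for the skipped indices: the argument depends
    only on the position in the word, as in [esum]. *)
Lemma dcoef_prod i len k u :
  dcoef (foldr (fun i acc => dmul (factor n Q i) acc) [:: fun _ => 1] (iota i len)) k u
  = (-1) ^+ k * esum [seq x n Q i | i <- iota i len] (len%:Z - k%:Z)
                  (u + n.+2%:R - i%:R).
Proof.
elim: len i k u => [|len IH] i k u.
  rewrite /dcoef; case: k => [|k] /=; first by rewrite expr0 mulr1.
  by rewrite nth_nil mulr0.
rewrite [LHS]dcoef_factor_mul /= !IH.
have -> : u + n.+2%:R - i.+1%:R = u + n.+2%:R - i%:R - 1 by ring.
have -> : u + n.+1%:R - i%:R = u + n.+2%:R - i%:R - 1 by ring.
have -> : len.+1%:Z - k%:Z - 1 = len%:Z - k%:Z by lia.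
rewrite mulrDr addrC mulrCA; congr (_ + _).
case: k => [|k].
  by rewrite esum_gt_size ?mulr0 ?oppr0 // size_map size_iota; lia.
rewrite IH exprS mulN1r mulNr.
have -> : len.+1%:Z - k.+1%:Z = len%:Z - k%:Z by lia.
by congr (- (_ * esum _ _ _)); ring.
Qed.

(* Letters are indexed from the middle: [m] stands for the pair (n-m, bar (n-m)). *)
Definition zpos m := z n Q (n - m).
Definition zneg m := zbar n Q (n - m).
Definition yratio m u :=
  Y n Q (n - m) (hs u (n - m)%N) / Y n Q (n - m) (hs u (n - m)%N + 1).

Hypothesis Q_neq0 : forall a u, (1 <= a <= n)%N -> Q a u != 0.

Lemma Y_neq0 a u : (a <= n)%N -> Y n Q a u != 0.
Proof.
move=> an; rewrite /Y; have [_|a0] := eqVneq a 0%N; first exact: oner_neq0.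
by rewrite mulf_neq0 ?invr_eq0 ?Q_neq0 // an lt0n a0.
Qed.

(** The shift m+1 aligns the arguments of the two factors [Y] of index n-m-1, which cancel. *)
Lemma zpos_zneg m u : (m < n)%N -> zpos m u * zneg m (u - m.+1%:R) = yratio m u.
Proof.
move=> mn; rewrite /zpos /zneg /yratio /z /zbar.
have nm : n%:R = (n - m)%N%:R + m%:R :> CC by rewrite -natrD subnK // ltnW.
have -> : hs (u - m.+1%:R) ((2 * n + 3)%N%:Z - (n - m)%N%:Z)
          = hs u (n - m + 1)%N.
  by rewrite /hs rmorphB /= -!pmulrn !natrD nm; field.
have -> : hs (u - m.+1%:R) ((2 * n + 4)%N%:Z - (n - m)%N%:Z)
          = hs u (n - m)%N + 1.
  by rewrite /hs rmorphB /= -!pmulrn !natrD nm; field.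
by rewrite mulrA divfK // Y_neq0 //; lia.
Qed.

(** One more unit of shift aligns the factors [Y] of index n-m instead; the ratio of index n-m-1
    survives. *)
Lemma zpos_znegS m u : (m < n)%N ->
  zpos m u * zneg m (u - m.+2%:R) = yratio m.+1 u.
Proof.
move=> mn; rewrite /zpos /zneg /yratio /z /zbar.
have nm : n%:R = (n - m)%N%:R + m%:R :> CC by rewrite -natrD subnK // ltnW.
have nmS : (n - m)%N%:R = (n - m.+1)%N%:R + 1 :> CC.
  by rewrite natr1; congr _%:R; lia.
have -> : hs (u - m.+2%:R) ((2 * n + 3)%N%:Z - (n - m)%N%:Z)
          = hs u (n - m.+1)%N.
  by rewrite /hs rmorphB /= -!pmulrn !natrD nm nmS; field.
have -> : hs (u - m.+2%:R) ((2 * n + 4)%N%:Z - (n - m)%N%:Z)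
          = hs u (n - m)%N.
  by rewrite /hs rmorphB /= -!pmulrn !natrD nm; field.
have -> : hs u (n - m + 1)%N = hs u (n - m.+1)%N + 1.
  by rewrite /hs -!pmulrn natrD nmS; field.
have -> : (n - m).-1 = (n - m.+1)%N by lia.
set a := Y _ _ _ _; set b := Y _ _ _ _; set c := Y _ _ _ _.
by rewrite mulrC mulrA divfK // Y_neq0 // leq_subr.
Qed.

(** As [dd n] is 2, with t = u + n/2 both sides are Q_n(t-1) Q_n(t+2) / (Q_n(t) Q_n(t+1)). *)
Lemma xX_xX u : (1 <= n)%N -> xX n Q u * xX n Q (u - 1) = yratio 0 u.
Proof.
move=> n1; rewrite /xX /yratio subn0 /Y (negPf (lt0n_neq0 n1)) /dd eqxx.
have -> : hs (u - 1) n = hs u n - 1 by rewrite /hs addrAC.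
have -> : hs (u - 1) (n + 4)%N = hs u n + 1.
  by rewrite /hs -!pmulrn natrD; field.
have -> : hs (u - 1) (n + 2)%N = hs u n by rewrite /hs -!pmulrn natrD; field.
have -> : hs u (n + 4)%N = hs u n + 2.
  by rewrite /hs -!pmulrn natrD; field.
have -> : hs u (n + 2)%N = hs u n + 1 by rewrite /hs -!pmulrn natrD; field.
have -> : (1 + true)%N%:~R / 2 = 1 :> CC by rewrite -pmulrn divff // pnatr_eq0.
have -> : hs u n + 1 + 1 = hs u n + 2 by ring.
have -> : hs u n + 1 - 1 = hs u n by ring.
by field; rewrite !Q_neq0 // n1 leqnn.
Qed.

Definition Esum m := esum [seq x n Q i | i <- iota (n - m).+1 (2 * m + 2)].

(** The two middle letters are opposite: the one-letter words cancel, and the two-letter word gives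
    the minus sign. *)
Lemma Esum0 j v : (1 <= n)%N ->
  Esum 0 j v = (j == 0)%:R - (j == 2)%:R * yratio 0 (v - 1).
Proof.
move=> n1; rewrite /Esum subn0 /= /x !ltnn eqxx leqNgt leqnSn /= !eqxx.
rewrite (_ : (n.+2 == n.+1) = false); last by lia.
rewrite -xX_xX //.
have -> : (j - 1 - 1 == 0) = (j == 2) by lia.
ring.
Qed.

Lemma EsumS m j v : (m < n)%N ->
  Esum m.+1 j v = Esum m j v + zpos m (v - 1) * Esum m (j - 1) (v - 1)
    + Esum m (j - 1) v * zneg m (v - j%:~R)
    + zpos m (v - 1) * Esum m (j - 2) (v - 1) * zneg m (v - j%:~R).
Proof.
move=> mn; rewrite /Esum.
(* The new pair has the indices n-m and n+m+3, on either side of the old range: one letter comes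
   first, the other last. *)
have -> : iota (n - m.+1).+1 (2 * m.+1 + 2)
  = (n - m)%N :: rcons (iota (n - m).+1 (2 * m + 2)) (n + m + 3)%N.
  have -> : (2 * m.+1 + 2 = (2 * m + 2 + 1).+1)%N by lia.
  rewrite /= subnSK //; congr (_ :: _).
  by rewrite iotaD cats1; congr rcons; lia.
rewrite /= map_rcons !esum_rcons.
have -> : x n Q (n - m) = zpos m by rewrite /x leq_subr.
have -> : x n Q (n + m + 3) = zneg m.
  rewrite /x (_ : (n + m + 3 <= n)%N = false); last by lia.
  rewrite (_ : (n + m + 3 == n.+1)%N = false); last by lia.
  rewrite (_ : (n + m + 3 == n.+2)%N = false); last by lia.
  by rewrite /zneg; congr zbar; lia.
have -> : j - 1 - 1 = j - 2 by ring.
have -> : v - 1 - (j - 1)%:~R = v - j%:~R by rewrite rmorphB /=; ring.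
ring.
Qed.

End LaxOperator.

(** * Admissible words as sets of letters *)

Lemma hsE (u : CC) (a k : nat) :
  hs u (a%:Z - (2 * k)%N%:Z) = hs u a%:Z - k%:R.
Proof. by rewrite /hs rmorphB /= -!pmulrn natrM; field. Qed.

Section SetSums.
Variables (N : nat).
Implicit Types (A B I : {set 'I_N}) (p i : 'I_N).

Definition rank A i := #|[set x in A | (x <= i)%N]|.

Lemma rankU1 p A i : p \notin A -> rank (p |: A) i = ((p <= i) + rank A i)%N.
Proof.
move=> pA; rewrite /rank; have [pi|pi] := leqP p i.
  have -> : [set x in p |: A | (x <= i)%N] = p |: [set x in A | (x <= i)%N].
    by apply/setP => x; rewrite !inE; case: eqP => [->|].
  by rewrite cardsU1 inE (negPf pA).
rewrite add0n; congr #|pred_of_set _|; apply/setP => x; rewrite !inE.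
by case: eqP => // ->; rewrite (negPf pA) leqNgt pi.
Qed.

Lemma rank_ge A i : (forall x, x \in A -> (x <= i)%N) -> rank A i = #|A|.
Proof.
by move=> h; congr #|pred_of_set _|; apply/setP => x; rewrite inE andb_idr //; exact: h.
Qed.

Lemma rank_lt A i : (forall x, x \in A -> (i < x)%N) -> rank A i = 0%N.
Proof.
move=> h; apply/eqP; rewrite cards_eq0; apply/eqP/setP => x; rewrite !inE.
by apply/negP => /andP[/h]; rewrite ltnNge => /negPf->.
Qed.

Lemma sum_subsetU1 (F : nmodType) p I (G : {set 'I_N} -> F) : p \notin I ->
  \sum_(A : {set 'I_N} | A \subset p |: I) G A =
  \sum_(A : {set 'I_N} | A \subset I) G A
  + \sum_(A : {set 'I_N} | A \subset I) G (p |: A).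
Proof.
move=> pI; rewrite (bigID (fun A => p \in A)) /= addrC; congr (_ + _).
  apply: eq_bigl => A; apply/andP/idP => [[AI pA]|AI].
    apply/subsetP => x xA; have := subsetP AI x xA; rewrite in_setU1.
    by case/orP => // /eqP xp; rewrite xp (negPf pA) in xA.
  split; first by apply: subset_trans AI (subsetUr _ _).
  by apply: contra pI => /(subsetP AI).
rewrite (reindex_onto (fun A => p |: A) (fun A => A :\ p)) /=; last first.
  by move=> A /andP[_ pA]; rewrite setD1K.
apply: eq_bigl => A; rewrite setU11 andbT; apply/andP/idP => [[AI /eqP pA]|AI].
  rewrite -pA; apply/subsetP => x; rewrite !inE => /andP[xp /orP[|xA]].
    by rewrite (negPf xp).
  have := subsetP AI x; rewrite !inE xA (negPf xp) orbT; exact.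
split; first exact: setUS.
by rewrite setU1K //; apply: contra pI => /(subsetP AI).
Qed.

(** [enum A] is a subsequence of the enumeration of ['I_N], whose values form an [iota]. *)
Lemma enum_val_ltn A (k l : 'I_#|A|) : (k < l)%N -> (enum_val k < enum_val l)%N.
Proof.
move=> kl; have s : sorted ltn (map val (enum A)).
  rewrite [enum A]/(enum_mem _) -enumT.
  apply: (@subseq_sorted _ ltn ltn_trans _ (map val (enum 'I_N))).
    by apply: map_subseq; exact: filter_subseq.
  by rewrite val_enum_ord; exact: iota_ltn_sorted.
have sz (i : 'I_#|A|) : (i < size (map val (enum A)))%N.
  by rewrite size_map -cardE.
have := sorted_ltn_nth ltn_trans 0%N s k l (sz k) (sz l) kl.
have x0 : 'I_N := enum_val k.
by rewrite /= !(nth_map x0) -?cardE // !(enum_val_nth x0).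
Qed.

End SetSums.

Section AdmissibleSums.
Variables (F : fieldType) (n : nat) (Q : nat -> CC -> F).
Implicit Types (A B : {set 'I_(2 * n)}) (p q i c : 'I_(2 * n)) (v : CC).

(* An increasing word is determined by its set of letters, and the position of a
   letter (counted from 1) is its rank. *)
Definition setwt A v := \prod_(i in A) zJ n Q i.+1 (v - (rank A i)%:R).

(* [rev_ord] is the bar involution, since letters are coded from 0 here. *)
Definition setadm A :=
  [forall c : 'I_(2 * n), [&& (c < n)%N, c \in A & rev_ord c \in A] ==>
    (rank A (rev_ord c) <= rank A c + (n - c.+1))%N].

(** The [m] innermost pairs: with codes starting at 0, b has code b-1 and bar b has code 2n-b. *)
Definition inner m := [set i : 'I_(2 * n) | (n - m <= i < n + m)%N].

(** Length and admissibility are tested in the summand, so that the range consists of all subsets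
    and splits by [sum_subsetU1]. *)
Definition Tsum m (j : int) v : F :=
  \sum_(A : {set 'I_(2 * n)} | A \subset inner m)
    (if (#|A|%:Z == j) && setadm A then setwt A v else 0).

(** * Increasing words correspond to their letter sets *)

Section Image.
Variable a : nat.
Implicit Types f g : {ffun 'I_a -> 'I_(2 * n)}.

Definition increasing f := [forall k : 'I_a, forall l : 'I_a,
  (k < l)%N ==> (f k < f l)%N].
Definition im f := [set f k | k : 'I_a].

Lemma increasing_ltn f : increasing f -> {mono f : k l / (k < l)%N}.
Proof.
move=> /forallP fi k l; have lt (k' l' : 'I_a) : (k' < l')%N -> (f k' < f l')%N.
  by move=> kl; have /forallP/(_ l')/implyP/(_ kl) := fi k'.
apply/idP/idP; last exact: lt.
by apply: contraTT; rewrite -!leqNgt leq_eqVlt => /orP[/eqP/val_inj->//|/lt/ltnW].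
Qed.

Lemma increasing_leq f : increasing f -> {mono f : k l / (k <= l)%N}.
Proof. by move=> fi k l; rewrite leqNgt (increasing_ltn fi) -leqNgt. Qed.

Lemma increasing_inj f : increasing f -> injective f.
Proof.
move=> fi k l fkl; apply/val_inj/eqP.
by rewrite eqn_leq -!(increasing_leq fi) fkl leqnn.
Qed.

Lemma rank_im f k : increasing f -> rank (im f) (f k) = k.+1.
Proof.
move=> fi; rewrite /rank.
have -> : [set x in im f | (x <= f k)%N] = f @: [set l : 'I_a | (l <= k)%N].
  apply/setP => x; rewrite inE; apply/andP/imsetP => [[/imsetP[l _ ->]]|[l]].
    by rewrite increasing_leq // => lk; exists l; rewrite ?inE.
  by rewrite inE => lk ->; rewrite increasing_leq // lk imset_f.
rewrite card_imset; last exact: increasing_inj.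
have wi : injective (widen_ord (ltn_ord k)).
  by move=> x y /(congr1 val) /= /val_inj.
rewrite -[RHS]card_ord -(card_imset _ wi).
congr #|pred_of_set _|; apply/setP => l; rewrite inE.
apply/idP/imsetP => [lk|[l' _ ->]]; last by rewrite /= -ltnS ltn_ord.
by exists (Ordinal (lk : (l < k.+1)%N)) => //; apply: val_inj.
Qed.

Lemma im_inj : {in increasing &, injective im}.
Proof.
move=> f g fi gi fg; apply/ffunP => k.
have : f k \in im g by rewrite -fg imset_f.
case/imsetP => l _ fkl; rewrite fkl; congr (g _); apply: val_inj.
by apply: succn_inj; rewrite -(rank_im l gi) -fg -fkl rank_im.
Qed.

Lemma im_surj A : #|A| = a -> exists2 f, increasing f & A = im f.
Proof.
move=> cA; pose f := [ffun k : 'I_a => enum_val (cast_ord (esym cA) k)].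
exists f.
  apply/forallP => k; apply/forallP => l; apply/implyP => kl.
  by rewrite !ffunE; apply: enum_val_ltn.
apply/setP => x; apply/idP/imsetP => [xA|[k _ ->]]; last first.
  by rewrite ffunE enum_valP.
exists (cast_ord cA (enum_rank_in xA x)) => //.
by rewrite ffunE cast_ordK enum_rankK_in.
Qed.

Lemma card_im f : increasing f -> #|im f| = a.
Proof. by move=> fi; rewrite card_imset ?card_ord //; exact: increasing_inj. Qed.

Lemma admissibleE f : admissible f = increasing f && setadm (im f).
Proof.
rewrite /admissible -/(increasing f); have [fi|//] := boolP (increasing f).
apply/forallP/forallP => [h c|h k].
  apply/implyP => /and3P[cn /imsetP[k _ ck] /imsetP[l _ cl]].
  have -> : rank (im f) c = k.+1 by rewrite ck rank_im.
  rewrite cl rank_im //.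
  have /forallP/(_ l)/forallP/(_ (Ordinal (cn : (c.+1 < n.+1)%N)))/implyP := h k.
  have := congr1 val cl; have := congr1 val ck; rewrite /= => <- <-.
  rewrite eqxx; have := ltn_ord c.
  rewrite (_ : (_ == _) = true) /=; last by apply/eqP; lia.
  by move=> c2 /(_ isT); lia.
apply/forallP => l; apply/forallP => c; apply/implyP => /and3P[c1 /eqP kc /eqP lc].
have /implyP := h (f k).
have lk : f l = rev_ord (f k) by apply: val_inj => /=; lia.
rewrite -lk !imset_f // !rank_im //= andbT.
have := ltn_ord c; lia.
Qed.

End Image.

Lemma inner_full : inner n = [set: 'I_(2 * n)].
Proof. by apply/setP => i; rewrite !inE; have := ltn_ord i; lia. Qed.

Lemma T1E a u : T1 n Q a u = Tsum n a (hs u a).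
Proof.
transitivity (\sum_(f : {ffun 'I_a -> 'I_(2 * n)} | admissible f)
    \prod_(k < a) zJ n Q (f k).+1 (hs u (a%:Z - (2 * k.+1)%N%:Z))).
  (* [T1] is 1 at [a = 0] by convention; the sum agrees, having the empty word as its only term. *)
  rewrite /T1; case: eqP => [->|//].
  have f0 : {ffun 'I_0 -> 'I_(2 * n)} by apply: finfun => -[].
  rewrite (big_pred1 f0).
    by rewrite big_ord0.
  move=> f; apply/idP/eqP => [_|_]; first by apply/ffunP => -[].
  apply/andP; split; apply/forallP => -[] //.
transitivity (\sum_(f in [set f : {ffun 'I_a -> 'I_(2 * n)} | admissible f])
    setwt (im f) (hs u a)).
  apply: eq_big => [f|f]; first by rewrite inE.
  rewrite admissibleE => /andP[fi _].
  rewrite /setwt big_imset /=; last by move=> k l _ _; apply: increasing_inj.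
  by apply: eq_big => // k _; rewrite rank_im // hsE.
rewrite -(big_imset (fun A => setwt A (hs u a))) /=; last first.
  move=> f g; rewrite !inE !admissibleE => /andP[fi _] /andP[gi _].
  exact: im_inj.
rewrite /Tsum -big_mkcondr /=; apply: eq_bigl => A.
rewrite inner_full subsetT /= eqz_nat.
apply/imsetP/andP => [[f]|[/eqP cA adA]].
  rewrite inE admissibleE => /andP[fi fa] ->.
  by rewrite card_im.
have [f fi Af] := im_surj cA; exists f => //.
by rewrite inE admissibleE fi -Af.
Qed.

Lemma Tsum0 j v : Tsum 0 j v = (j == 0)%:R.
Proof.
rewrite /Tsum (big_pred1 set0); last first.
  move=> A; rewrite (_ : inner 0 = set0) ?subset0 //.
  by apply/setP => i; rewrite !inE; lia.
rewrite cards0 (eq_sym 0%:Z) /setwt big_set0.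
rewrite (_ : setadm set0) ?andbT; first by case: (j == 0).
by apply/forallP => c; rewrite !inE /= andbF.
Qed.

(** * Adding the outermost pair of letters *)

Section Peel.
Variables (m : nat) (mn : (m < n)%N).
Variable p : 'I_(2 * n).
Hypothesis pE : p = (n - m.+1)%N :> nat.
Let q := rev_ord p.

Let qE : q = (n + m)%N :> nat.
Proof. by rewrite /q /= pE; lia. Qed.

Let pq : p != q.
Proof. by rewrite -val_eqE /= pE; lia. Qed.

Lemma p_inner : p \notin inner m.
Proof. by rewrite inE pE; lia. Qed.

Lemma q_inner : q \notin inner m.
Proof. by rewrite inE qE; lia. Qed.

Lemma innerS : inner m.+1 = p |: (q |: inner m).
Proof. by apply/setP => i; rewrite !inE -!val_eqE [val p]pE [val q]qE /=; lia. Qed.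

Variable B : {set 'I_(2 * n)}.
Hypothesis BI : B \subset inner m.

Let Bin i : i \in B -> (n - m <= i < n + m)%N.
Proof. by move/(subsetP BI); rewrite inE. Qed.

Let pB : p \notin B.
Proof. by apply: contra p_inner => /(subsetP BI). Qed.

Let qB : q \notin B.
Proof. by apply: contra q_inner => /(subsetP BI). Qed.

Let pqB : p \notin q |: B.
Proof. by rewrite !inE (negPf pq). Qed.

Let B_q i : i \in B -> (i <= q)%N.
Proof. by move/Bin; rewrite qE; lia. Qed.

Let B_p i : i \in B -> (p < i)%N.
Proof. by move/Bin; rewrite pE; lia. Qed.

(** [p] precedes all of [B], so it takes position 1 and moves every other letter one place on. *)
Lemma setwt_p v : setwt (p |: B) v = zpos n Q m (v - 1) * setwt B (v - 1).
Proof.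
rewrite /setwt big_setU1 //= rankU1 // leqnn rank_lt // addn0; congr (_ * _).
  by rewrite /zpos pE /zJ ifT; [congr z; lia|lia].
apply: eq_bigr => i iB; rewrite rankU1 // (ltnW (B_p iB)).
by congr zJ; rewrite natrD /=; ring.
Qed.

Lemma zJ_q u : zJ n Q q.+1 u = zneg n Q m u.
Proof. by rewrite /zneg qE /zJ ifF; [congr zbar; lia|lia]. Qed.

Lemma setwt_q v : setwt (q |: B) v = setwt B v * zneg n Q m (v - #|B|.+1%:R).
Proof.
rewrite /setwt big_setU1 //= rankU1 // leqnn rank_ge // add1n zJ_q mulrC.
congr (_ * _); apply: eq_bigr => i iB; rewrite rankU1 //.
by have iI := Bin iB; rewrite (_ : (q <= i)%N = false) // qE; lia.
Qed.

Lemma setwt_pq v : setwt (p |: (q |: B)) v =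
  zpos n Q m (v - 1) * setwt B (v - 1) * zneg n Q m (v - #|B|.+2%:R).
Proof.
rewrite setUCA /setwt big_setU1 /=; last by rewrite !inE eq_sym (negPf pq).
rewrite -/(setwt _ _) rankU1; last by rewrite !inE eq_sym (negPf pq).
rewrite leqnn rank_ge ?cardsU1 ?pB ?zJ_q; last first.
  by move=> x /setU1P[->|/B_q//]; rewrite pE qE; lia.
rewrite -setwt_p mulrC; congr (_ * _); apply: eq_bigr => i ipB.
rewrite rankU1; last by rewrite !inE eq_sym (negPf pq).
rewrite (_ : (q <= i)%N = false) //.
by move: ipB => /setU1P[->|/Bin]; rewrite ?pE qE; lia.
Qed.

(** The partner of [a] is absent, so no new condition arises; and [a] raises both ranks of a pair in
    [B] or neither. *)
Lemma setadmU1 a : a \notin B -> rev_ord a \notin a |: B ->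
  (forall c, c \in B -> rev_ord c \in B -> (a <= c) = (a <= rev_ord c))%N ->
  setadm (a |: B) = setadm B.
Proof.
move=> aB ra ac; apply/forallP/forallP => h c; apply/implyP => /and3P[cn cB rcB].
  have /implyP := h c; rewrite cn !inE cB rcB !orbT => /(_ isT).
  by rewrite !rankU1 // (ac _ cB rcB); lia.
have {}cB : c \in B.
  by case/setU1P: cB => // ca; rewrite ca (negPf ra) in rcB.
have {}rcB : rev_ord c \in B.
  case/setU1P: rcB => // ca.
  by move: ra; rewrite -ca rev_ordK !inE cB orbT.
have /implyP := h c; rewrite cn cB rcB => /(_ isT).
by rewrite !rankU1 // (ac _ cB rcB); lia.
Qed.

Lemma setadm_p : setadm (p |: B) = setadm B.
Proof.
apply: setadmU1 => // [|c cB rcB].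
  by rewrite -/q !inE eq_sym (negPf pq).
by rewrite !(ltnW (B_p _)).
Qed.

Lemma setadm_q : setadm (q |: B) = setadm B.
Proof.
apply: setadmU1 => // [|c cB rcB]; first by rewrite rev_ordK.
have := Bin cB; have := Bin rcB; rewrite qE => h1 h2; lia.
Qed.

(** Pairs inside [B] have both ranks raised by 1. The new pair has ranks 1 and [#|B| + 2], and its
    condition [#|B| + 2 <= 1 + m] is the extra bound. *)
Lemma setadm_pq : setadm (p |: (q |: B)) = setadm B && (#|B| < m)%N.
Proof.
have rk i : rank (p |: (q |: B)) i = ((p <= i) + ((q <= i) + rank B i))%N.
  by rewrite !rankU1.
have rp : rank (p |: (q |: B)) p = 1%N.
  rewrite rk leqnn rank_lt // (_ : (q <= p)%N = false) // pE qE; lia.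
have rq : rank (p |: (q |: B)) q = #|B|.+2.
  by rewrite rk leqnn rank_ge // (_ : (p <= q)%N) // pE qE; lia.
have rB c : c \in B -> rank (p |: (q |: B)) c = (rank B c).+1.
  move=> cB; rewrite rk (ltnW (B_p cB)) (_ : (q <= c)%N = false) //.
  by have := Bin cB; rewrite qE; lia.
apply/forallP/andP => [h|[/forallP h Bm] c].
  split; last first.
    have /implyP := h p; rewrite -/q rp rq !inE !eqxx !orbT pE /=.
    by rewrite (_ : (_ < n)%N) => [/(_ isT)|]; lia.
  apply/forallP => c; apply/implyP => /and3P[cn cB rcB].
  have /implyP := h c; rewrite cn !inE cB rcB !orbT => /(_ isT).
  by rewrite !rB //; lia.
apply/implyP => /and3P[cn cB rcB].
case/setU1P: cB => [cp|/setU1P[cq|cB]].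
- by rewrite cp -/q rp rq pE; lia.
- by exfalso; move: cn; rewrite cq qE ltnNge leq_addr.
have {}rcB : rev_ord c \in B.
  have := Bin cB; case/setU1P: rcB => [|/setU1P[|//]] /(congr1 val) /=.
    by rewrite pE; lia.
  by rewrite ?qE ?pE; lia.
have /implyP := h c; rewrite cn cB rcB => /(_ isT).
by rewrite !rB //; lia.
Qed.

End Peel.

Lemma peel_ord m : (m < n)%N -> exists p : 'I_(2 * n), p = (n - m.+1)%N :> nat.
Proof.
move=> mn; have h : (n - m.+1 < 2 * n)%N by lia.
by exists (Ordinal h).
Qed.

Lemma sum_inner m p (G : {set 'I_(2 * n)} -> F) : (m < n)%N ->
  p = (n - m.+1)%N :> nat ->
  \sum_(A : {set 'I_(2 * n)} | A \subset inner m.+1) G A =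
  \sum_(B : {set 'I_(2 * n)} | B \subset inner m)
    (G B + G (p |: B) + G (rev_ord p |: B) + G (p |: (rev_ord p |: B))).
Proof.
move=> mn pE; rewrite (innerS mn pE) sum_subsetU1; last first.
  by rewrite !inE pE -val_eqE /= pE; lia.
rewrite !sum_subsetU1 ?(q_inner mn pE) // !big_split /=.
by rewrite -!addrA; congr (_ + _); rewrite addrCA.
Qed.

(** Going from [m] to m+1 adds at most one letter, or both to a set of fewer than [m] letters. *)
Lemma card_setadm m A : (m <= n)%N -> A \subset inner m -> setadm A ->
  (#|A| <= m)%N.
Proof.
elim: m A => [|m IH] A mn.
  have -> : inner 0 = set0 by apply/setP => i; rewrite !inE; lia.
  by rewrite subset0 => /eqP ->; rewrite cards0.
have [p pE] := peel_ord mn; set q := rev_ord p.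
rewrite (innerS mn pE) -/q => AI.
have BI : A :\ p :\ q \subset inner m.
  apply/subsetP => x; rewrite !inE => /and3P[xq xp /(subsetP AI)].
  by rewrite !inE (negPf xq) (negPf xp).
have D1 (X : {set 'I_(2 * n)}) y : X = y |: (X :\ y) \/ X = X :\ y.
  have [yX|yX] := boolP (y \in X); [left|right]; first by rewrite setD1K.
  by apply/setP => x; rewrite !inE; case: eqP => // ->; rewrite (negPf yX).
move: (D1 A p) (D1 (A :\ p) q) BI.
move: (A :\ p :\ q) => B; move: (A :\ p) => A1.
move=> [] -> [] -> BI; have IHB := IH B (ltnW mn) BI.
- by rewrite (setadm_pq mn pE BI) => /andP[_]; rewrite !cardsU1; lia.
- by rewrite (setadm_p mn pE BI) => /IHB; rewrite cardsU1; lia.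
- by rewrite (setadm_q mn pE BI) => /IHB; rewrite cardsU1; lia.
by move=> /IHB; lia.
Qed.

Lemma Tsum_gt m (j : int) v : (m <= n)%N -> m%:Z < j -> Tsum m j v = 0.
Proof.
move=> mn mj; apply: big1 => A AI; case: ifP => // /andP[/eqP cA adA].
by have := card_setadm mn AI adA; lia.
Qed.

(** The bound on [j] makes the extra condition of [setadm_pq] automatic: there [B] has j-2 < m
    letters. *)
Lemma TsumS m (j : int) v : (m < n)%N -> j <= m.+1%:Z ->
  Tsum m.+1 j v = Tsum m j v + zpos n Q m (v - 1) * Tsum m (j - 1) (v - 1)
    + Tsum m (j - 1) v * zneg n Q m (v - j%:~R)
    + zpos n Q m (v - 1) * Tsum m (j - 2) (v - 1) * zneg n Q m (v - j%:~R).
Proof.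
move=> mn jm; have [p pE] := peel_ord mn; rewrite /Tsum (sum_inner _ mn pE).
rewrite !mulr_sumr !mulr_suml -!big_split /=; apply: eq_bigr => B BI.
have pI := p_inner mn pE; have qI := q_inner mn pE.
have pB : p \notin B by apply: contra pI => /(subsetP BI).
have qB : rev_ord p \notin B by apply: contra qI => /(subsetP BI).
have pqB : p \notin rev_ord p |: B.
  by rewrite !inE (negPf pB) orbF -val_eqE /= pE; lia.
rewrite (setadm_p mn pE BI) (setadm_q mn pE BI) (setadm_pq mn pE BI).
rewrite (setwt_p mn pE BI) (setwt_q mn pE BI) (setwt_pq mn pE BI).
rewrite !cardsU1 pB qB pqB /=.
have c1 : (#|B|%:Z == j - 1) = ((1 + #|B|)%N%:Z == j) by lia.
have c2 : (#|B|%:Z == j - 2) = ((1 + (1 + #|B|))%N%:Z == j) by lia.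
rewrite c1 c2; congr (_ + _ + _ + _).
- by case: ifP => _ //; rewrite mulr0.
- by case: eqP => [<-|_] /=; [case: setadm; rewrite ?mul0r // -pmulrn|rewrite mul0r].
case: eqP => [jE|_] /=; last by rewrite mulr0 mul0r.
have Bm : (#|B| < m)%N by move: jm; rewrite -jE lez_nat.
rewrite Bm andbT.
by case: setadm; rewrite ?mulr0 ?mul0r // -jE -pmulrn.
Qed.

End AdmissibleSums.

(** * Reading off the coefficients of [L] *)

Theorem mainTheorem4 (F : fieldType) (n : nat) (Q : nat -> CC -> F) :
  (2 <= n)%N ->
  (forall a u, (1 <= a <= n)%N -> Q a u != 0) ->
  forall (i : nat) (u : CC),
    dcoef (Lop n Q) i u =
      if (i <= n)%N then - ((-1) ^+ i * T1 n Q i (hs u i))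
      else if i == n.+1 then 0
      else if (i <= 2 * n + 2)%N then (-1) ^+ i * T1 n Q (2 * n + 2 - i) (hs u i)
      else 0.
Proof.
move=> n2 Q0 i u; have n1 : (1 <= n)%N by lia.
have [lowE highE] := duality (@zpos_zneg F n Q Q0) (@zpos_znegS F n Q Q0)
  (fun j v => Esum0 Q0 j v n1) (@EsumS F n Q) (@Tsum0 F n Q) (@Tsum_gt F n Q)
  (@TsumS F n Q) (leqnn n).
rewrite /Lop dcoef_prod.
have -> : u + n.+2%:R - 1%:R = u + n.+1%:R by ring.
have -> : [seq x n Q i0 | i0 <- iota 1 (2 * n + 2)]
  = [seq x n Q i0 | i0 <- iota (n - n).+1 (2 * n + 2)] by rewrite subnn.
rewrite -/(Esum n Q n).
(* At [m = n] the ratio involves only [Y] of index 0, which is 1. *)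
have w1 s v : shiftprod (yratio n Q n) s v = 1.
  by apply: big1 => k _; rewrite /yratio subnn /Y eqxx divr1.
have hs2 (k : nat) : hs (hs u k) k = u + k%:R.
  by rewrite /hs -!pmulrn; field.
have [le_in|lt_ni] := leqP i n.
  (* Long words: s = n+1-i gives the dual length n+1-s = i and the argument u+n+1-s = u+i. *)
  have -> : (2 * n + 2)%N%:Z - i%:Z = (n.+1 + (n.+1 - i))%N%:Z by lia.
  rewrite highE w1 mul1r T1E hs2 mulrN.
  congr (- (_ * _)); congr Tsum; first by lia.
  by rewrite natrB ?leqW //; ring.
have [->|ni1] := eqVneq i n.+1.
  have -> : (2 * n + 2)%N%:Z - n.+1%:Z = (n.+1 + 0)%N%:Z by lia.
  by rewrite highE Tsum_gt ?mulr0 ?oppr0 ?mulr0 //; lia.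
have [le_iN|lt_Ni] := leqP i (2 * n + 2).
  (* Short words: no duality is involved, and u+n+1 is u+i/2 plus half the length. *)
  have -> : (2 * n + 2)%N%:Z - i%:Z = (2 * n + 2 - i)%N%:Z by lia.
  rewrite lowE; last by lia.
  rewrite T1E; congr (_ * _); congr Tsum.
  rewrite /hs -!pmulrn natrB // natrD natrM.
  by field.
by rewrite /Esum esum_lt0 ?mulr0 //; lia.
Qed.
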